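(* Assume Setting A, suppose $\mathbf I(\lambda^\circ)$ is positive definite, and suppose $E\|D_\lambda\log p_k^*(X_k;\lambda^\circ)\|^2<\infty$ and $E\|D^2_{\lambda\lambda}\log p_k^*(X_k;\lambda^\circ)\|<\infty$ for all $k$. Let $\mathbf W$ be the $K\times K$ matrix with entries $W_{kl}=\Delta_{kl}n_k^{-1}+n_0^{-1}$ ($k,l=1,\dots,K$, $\Delta$ the Kronecker delta). Then (a) $\mathbf I(\lambda^\circ)-\boldsymbol\Sigma(\lambda^\circ)=\mathbf I(\lambda^\circ)\begin{bmatrix}\mathbf 0&\mathbf 0\\ \mathbf 0&\mathbf W\end{bmatrix}\mathbf I(\lambda^\circ)$ (blocks of sizes $S$ and $K$); (b) $[\mathbf I^{-1}(\lambda^\circ)]_{\theta\theta}=[\mathbf I^{-1}(\lambda^\circ)\,\boldsymbol\Sigma(\lambda^\circ)\,\mathbf I^{-1}(\lambda^\circ)]_{\theta\theta}$, where $[\cdot]_{\theta\theta}$ denotes the upper-left $S\times S$ block.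
   Context: Setting A. Let $(\Omega_X,\mathcal B_X)$, $(\Omega_Y,\mathcal B_Y)$ be measurable spaces with a $\sigma$-finite measure $\nu_X$ on $\Omega_X$. Fix $K\ge1$, distinct $y_0,\dots,y_K\in\Omega_Y$, $S\ge1$, and for $\theta\in\mathbb R^S$ and $k=0,\dots,K$ measurable functions $x\mapsto\psi_\theta(x,y_k)$ on $\Omega_X$ with $\psi_\theta(x,y_0)=0$, such that $\theta\mapsto\psi_\theta(x,y_k)$ is three times continuously differentiable for every $x$. Let $\theta^\circ\in\mathbb R^S$ (true parameter) and for each $k$ let $f_k$ be an everywhere positive probability density on $\Omega_X$ w.r.t. $\nu_X$ of the form $\log f_k(x)=\beta(x)+\psi_{\theta^\circ}(x,y_k)-\varepsilon_k$ with a measurable $\beta$ and constants $\varepsilon_k$ (these are the conditional densities of $X$ given $Y=y_k$ under the association model with log-odds ratio $\psi_{\theta^\circ}$). $X_k$ denotes a random element with density $f_k$. Fix $\bar r_0,\dots,\bar r_K>0$ with $\sum_k\bar r_k=1$. On a common probability space let $(X_{ki})_{i\ge1}$, $k=0,\dots,K$, be independent i.i.d. sequences with $X_{ki}\sim X_k$; for $n$ in an increasing sequence with $n_k=\bar r_kn\in\mathbb N$ for all $k$, the sample is $\{X_{ki}:k=0,\dots,K,\ i\le n_k\}$. For $\lambda=(\theta,\gamma^* )\in\mathbb R^S\times\mathbb R^K$, $\gamma^*=(\gamma_1^*,\dots,\gamma_K^* )$, $\gamma_0^*:=0$, put $p_k^*(x;\lambda)=\exp(\gamma_k^*+\psi_\theta(x,y_k))/\sum_{l=0}^K\exp(\gamma_l^*+\psi_\theta(x,y_l))$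 and $\ell^{(n)}(\lambda)=\sum_{k=0}^K\sum_{i=1}^{n_k}\log p_k^*(X_{ki};\lambda)$. The true value is $\lambda^\circ=(\theta^\circ,\gamma^\circ)$ with $\gamma_k^\circ=\log\bar r_k-\varepsilon_k-\log\bar r_0+\varepsilon_0$, so that $p_k^*(x;\lambda^\circ)=\bar r_kf_k(x)/\sum_l\bar r_lf_l(x)$. $D_\lambda$ denotes the gradient in $\lambda$, $\mathbf J^{(n)}(\lambda)=-D^2_{\lambda\lambda}\ell^{(n)}(\lambda)$; $E$, $\mathrm{Cov}$, $P$ refer to the true distribution. Define $\bar{\mathbf I}(\lambda)=\sum_k\bar r_kE[-D^2_{\lambda\lambda}\log p_k^*(X_k;\lambda)]$, $\bar{\boldsymbol\Sigma}(\lambda)=\sum_k\bar r_k\mathrm{Cov}(D_\lambda\log p_k^*(X_k;\lambda))$, $\mathbf I(\lambda)=n\bar{\mathbf I}(\lambda)=E\mathbf J^{(n)}(\lambda)$, $\boldsymbol\Sigma(\lambda)=n\bar{\boldsymbol\Sigma}(\lambda)=\mathrm{Cov}(D_\lambda\ell^{(n)}(\lambda))$. *)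

(* Defs.v *)
From HB Require Import structures.
From mathcomp Require Import all_boot all_order all_algebra.
From mathcomp Require Import all_classical all_reals all_analysis.
Set Implicit Arguments. Unset Strict Implicit. Unset Printing Implicit Defensive.
Import Order.TTheory GRing.Theory Num.Theory.
Import numFieldNormedType.Exports.
Local Open Scope classical_set_scope.
Local Open Scope ring_scope.

Definition ebasis (R : realType) (n : nat) (i : 'I_n) : 'rV[R]_n := delta_mx 0 i.

Definition partial (R : realType) (n : nat) (f : 'rV[R]_n -> R) (i : 'I_n)
  : 'rV[R]_n -> R := fun x => 'D_(ebasis R i) f x.

Definition C3 (R : realType) (n : nat) (f : 'rV[R]_n -> R) : Prop :=
  continuous f /\
  (forall i x, derivable f x (ebasis R i)) /\
  (forall i, continuous (partial f i)) /\
  (forall i j x, derivable (partial f i) x (ebasis R j)) /\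
  (forall i j, continuous (partial (partial f i) j)) /\
  (forall i j l x, derivable (partial (partial f i) j) x (ebasis R l)) /\
  (forall i j l, continuous (partial (partial (partial f i) j) l)).

Definition gam (R : realType) (K : nat) (g : 'rV[R]_K) (k : 'I_K.+1) : R :=
  if unlift ord0 k is Some j then g ord0 j else 0.

Definition pstar (R : realType) (TX TY : Type) (S K : nat)
  (psi : 'rV[R]_S -> TX -> TY -> R) (y : 'I_K.+1 -> TY)
  (k : 'I_K.+1) (lam : 'rV[R]_(S + K)) (x : TX) : R :=
  expR (gam (rsubmx lam) k + psi (lsubmx lam) x (y k)) /
  \sum_(l < K.+1) expR (gam (rsubmx lam) l + psi (lsubmx lam) x (y l)).

Definition logp (R : realType) (TX TY : Type) (S K : nat)
  (psi : 'rV[R]_S -> TX -> TY -> R) (y : 'I_K.+1 -> TY)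
  (k : 'I_K.+1) (lam : 'rV[R]_(S + K)) (x : TX) : R :=
  ln (pstar psi y k lam x).

Definition grad (R : realType) (TX TY : Type) (S K : nat)
  (psi : 'rV[R]_S -> TX -> TY -> R) (y : 'I_K.+1 -> TY)
  (k : 'I_K.+1) (lam : 'rV[R]_(S + K)) (x : TX) (i : 'I_(S + K)) : R :=
  partial (fun l => logp psi y k l x) i lam.

Definition hess (R : realType) (TX TY : Type) (S K : nat)
  (psi : 'rV[R]_S -> TX -> TY -> R) (y : 'I_K.+1 -> TY)
  (k : 'I_K.+1) (lam : 'rV[R]_(S + K)) (x : TX) (i j : 'I_(S + K)) : R :=
  partial (partial (fun l => logp psi y k l x) i) j lam.

Definition Edens (R : realType) (d : measure_display) (TX : measurableType d)
  (nu : {measure set TX -> \bar R}) (fk : TX -> R) (g : TX -> R) : R :=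
  fine (\int[nu]_x (g x * fk x)%:E).

Definition Ibar (R : realType) (d : measure_display) (TX : measurableType d)
  (TY : Type) (S K : nat) (nu : {measure set TX -> \bar R})
  (f : 'I_K.+1 -> TX -> R) (r : 'I_K.+1 -> R)
  (psi : 'rV[R]_S -> TX -> TY -> R) (y : 'I_K.+1 -> TY)
  (lam : 'rV[R]_(S + K)) : 'M[R]_(S + K) :=
  \matrix_(i, j) \sum_(k < K.+1)
     r k * Edens nu (f k) (fun x => - hess psi y k lam x i j).

Definition CovScore (R : realType) (d : measure_display) (TX : measurableType d)
  (TY : Type) (S K : nat) (nu : {measure set TX -> \bar R})
  (f : 'I_K.+1 -> TX -> R)
  (psi : 'rV[R]_S -> TX -> TY -> R) (y : 'I_K.+1 -> TY)
  (k : 'I_K.+1) (lam : 'rV[R]_(S + K)) : 'M[R]_(S + K) :=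
  \matrix_(i, j) Edens nu (f k) (fun x =>
     (grad psi y k lam x i - Edens nu (f k) (fun z => grad psi y k lam z i)) *
     (grad psi y k lam x j - Edens nu (f k) (fun z => grad psi y k lam z j))).

Definition Sigbar (R : realType) (d : measure_display) (TX : measurableType d)
  (TY : Type) (S K : nat) (nu : {measure set TX -> \bar R})
  (f : 'I_K.+1 -> TX -> R) (r : 'I_K.+1 -> R)
  (psi : 'rV[R]_S -> TX -> TY -> R) (y : 'I_K.+1 -> TY)
  (lam : 'rV[R]_(S + K)) : 'M[R]_(S + K) :=
  \sum_(k < K.+1) r k *: CovScore nu f psi y k lam.

Definition lam0 (R : realType) (S K : nat) (theta0 : 'rV[R]_S)
  (r eps : 'I_K.+1 -> R) : 'rV[R]_(S + K) :=
  row_mx theta0 (\row_(j < K) (ln (r (lift ord0 j)) - eps (lift ord0 j)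
                               - ln (r ord0) + eps ord0)).

Definition Wmat (R : realType) (K : nat) (nk : 'I_K.+1 -> nat) : 'M[R]_K :=
  \matrix_(k, l) ((k == l)%:R / (nk (lift ord0 k))%:R + 1 / (nk ord0)%:R).

(* Main.v *)
(** The model is multinomial logistic: with eta_k the logits and q the softmax
weights, the score of category k is g_k = D eta_k - sum_l q_l D eta_l.  At the
true parameter r_k f_k = c q_k pointwise, with c independent of k, so every
mixture sum_k r_k E_k is the integral of c times a softmax average.  Pointwise
softmax identities then give, with mu_k = E_k g_k,
  Ibar = sum_k r_k E_k [g_k^T g_k],  so  Ibar - Sigbar = sum_k r_k mu_k^T mu_k,
  sum_k r_k mu_k = 0,  and the gamma_l row of Ibar equals r_l mu_l.
The last fact makes I [0 0; 0 W] I a quadratic form in the mu_k, and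
sum_k r_k mu_k = 0 turns its rank-one part 1/n_0 into the missing term k = 0. *)
Require Import Defs.
From HB Require Import structures.
From mathcomp Require Import all_boot all_order all_algebra.
From mathcomp Require Import all_classical all_reals all_analysis.
From mathcomp Require Import measurable_realfun ring lra.
Import Order.TTheory GRing.Theory Num.Theory.
Import numFieldNormedType.Exports.
Local Open Scope classical_set_scope.
Local Open Scope ring_scope.

(** * Calculus of directional derivatives of real-valued functions *)

Section DirectionalDerivative.
Context {R : realType} {V : normedModType R}.
Implicit Types (f : V -> R) (x v : V).

(** Both difference quotients are the same function of the step, so a derivative along [v] becomes a
    one-variable derivative at 0 and the one-variable chain rule applies. *)
Lemma is_derive_line f x v df :
  is_derive x v f df <-> is_derive (0 : R) (1 : R) (fun h : R => f (h *: v + x)) df.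
Proof.
suff E : 'D_v f x = 'D_(1 : R) (fun h : R => f (h *: v + x)) 0.
  by split=> -[dx <-]; split; rewrite ?E//; apply/(derivable1P f x v).
rewrite /derive; set g1 := fun h => h^-1 *: _; set g2 := fun h => h^-1 *: _.
suff -> : g1 = g2 by [].
by rewrite funeqE /g1 /g2 => h /=; rewrite addr0 scale0r add0r [_%:A]mulr1.
Qed.

Lemma is_derive_comp1 (g : R -> R) f x v (df dg : R) :
  is_derive x v f df -> is_derive (f x) (1 : R) g dg ->
  is_derive x v (g \o f) (dg * df).
Proof.
move=> /is_derive_line hf hg; apply/is_derive_line.
apply: (is_derive1_comp (g := fun h => f (h *: v + x))).
by rewrite scale0r add0r.
Qed.

Lemma is_derive_sumfun n (h : 'I_n -> V -> R) x v (dh : 'I_n -> R) :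
  (forall i, is_derive x v (h i) (dh i)) ->
  is_derive x v (fun z => \sum_(i < n) h i z) (\sum_(i < n) dh i).
Proof.
move=> hd; rewrite (_ : (fun z => _) = \sum_(i < n) h i); first exact: is_derive_sum.
by apply/funext => z; rewrite fct_sumE.
Qed.

Lemma is_derive_mulfun f g x v (df dg : R) :
  is_derive x v f df -> is_derive x v g dg ->
  is_derive x v (fun z => f z * g z) (f x * dg + df * g x).
Proof.
move=> hf hg; have := is_deriveM hf hg.
by rewrite /GRing.scale/= [g x * df]mulrC.
Qed.

End DirectionalDerivative.

(** * Softmax weights, their means and their derivatives *)

Definition softmax {R : realType} {V : Type} {n : nat}
    (eta : 'I_n -> V -> R) (k : 'I_n) (x : V) : R :=
  expR (eta k x) / \sum_(l < n) expR (eta l x).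

Definition smean {R : realType} {V : Type} {n : nat}
    (eta : 'I_n -> V -> R) (x : V) (a : 'I_n -> R) : R :=
  \sum_(l < n) softmax eta l x * a l.

Section Softmax.
Context {R : realType} {V : normedModType R} {n : nat}.
Variable eta : 'I_n.+1 -> V -> R.

Lemma sum_expR_gt0 x : 0 < \sum_(l < n.+1) expR (eta l x).
Proof.
rewrite big_ord_recl ltr_pwDl ?expR_gt0//.
by apply: sumr_ge0 => i _; exact: expR_ge0.
Qed.

Lemma softmax_gt0 k x : 0 < softmax eta k x.
Proof. by rewrite divr_gt0 ?expR_gt0 ?sum_expR_gt0. Qed.

Lemma sum_softmax x : \sum_(l < n.+1) softmax eta l x = 1.
Proof. by rewrite -mulr_suml divff// gt_eqF ?sum_expR_gt0. Qed.

Lemma ln_softmaxE k x :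
  ln (softmax eta k x) = eta k x - ln (\sum_(l < n.+1) expR (eta l x)).
Proof.
rewrite lnM ?posrE ?invr_gt0 ?expR_gt0 ?sum_expR_gt0//.
by rewrite lnV ?posrE ?sum_expR_gt0// expRK.
Qed.

Lemma softmaxE k x : softmax eta k x = expR (ln (softmax eta k x)).
Proof. by rewrite lnK// posrE softmax_gt0. Qed.

Variables (x v : V) (de : 'I_n.+1 -> R).
Hypothesis hde : forall l, is_derive x v (eta l) (de l).

(** The log-weight is [eta k] minus the log-partition function, and the derivative of the latter is
    the softmax mean of [de]. *)
Lemma is_derive_ln_softmax k :
  is_derive x v (fun z => ln (softmax eta k z)) (de k - smean eta x de).
Proof.
have hE : is_derive x v (fun z => \sum_(l < n.+1) expR (eta l z))
    (\sum_(l < n.+1) expR (eta l x) * de l).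
  by apply: is_derive_sumfun => l; exact: (@is_derive_comp1 _ _ expR).
have hL := is_derive_comp1 _ _ _ _ _ _ hE (is_derive1_ln (sum_expR_gt0 x)).
rewrite (_ : (fun z => _) =
    eta k - (@ln R \o (fun z => \sum_(l < n.+1) expR (eta l z)))).
  rewrite (_ : smean _ _ _ = (\sum_(l < n.+1) expR (eta l x))^-1 *
      (\sum_(l < n.+1) expR (eta l x) * de l)).
    exact: is_deriveB.
  rewrite mulr_sumr; apply: eq_bigr => l _.
  by rewrite mulrA [_^-1 * _]mulrC.
by apply/funext => z; rewrite ln_softmaxE.
Qed.

Lemma is_derive_softmax k :
  is_derive x v (softmax eta k) (softmax eta k x * (de k - smean eta x de)).
Proof.
rewrite (_ : softmax eta k = expR \o (fun z => ln (softmax eta k z))).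
  rewrite /= -softmaxE; apply: is_derive_comp1; first exact: is_derive_ln_softmax.
  by rewrite [X in is_derive _ _ _ X]softmaxE; exact: is_derive_expR.
by apply/funext => z /=; rewrite -softmaxE.
Qed.

(** Product rule: the first term differentiates [a]; the second differentiates the weights and is
    the softmax covariance of [a] and [de]. *)
Lemma is_derive_smean (a : 'I_n.+1 -> V -> R) (da : 'I_n.+1 -> R) :
  (forall l, is_derive x v (a l) (da l)) ->
  is_derive x v (fun z => smean eta z (a^~ z))
    (smean eta x da + smean eta x (fun l => a l x * (de l - smean eta x de))).
Proof.
move=> ha; rewrite -big_split/=; apply: is_derive_sumfun => l.
have := is_derive_mulfun _ _ _ _ _ _ (is_derive_softmax l) (ha l).
by congr is_derive; ring.
Qed.

End Softmax.

(** * Derivatives through linear maps, and measurability of derivatives *)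

Lemma is_derive_comp_linear (R : realType) (V W : normedModType R)
    (g : {linear V -> W}) (f : W -> R) (x v : V) (df : R) :
  is_derive (g x) (g v) f df -> is_derive x v (f \o g) df.
Proof.
move=> /is_derive_line h; apply/is_derive_line.
by under eq_fun do rewrite /= linearP.
Qed.

Lemma is_derive_coord (R : realType) n (i : 'I_n) (x v : 'rV[R]_n) :
  is_derive x v (fun z : 'rV[R]_n => z 0 i) (v 0 i).
Proof.
apply/is_derive_line.
under eq_fun do rewrite !mxE.
by apply: is_derive_eq; rewrite addr0 /GRing.scale/= mulr1 mulr0 add0r.
Qed.

Lemma is_derive_dir0 (R : realType) (V : normedModType R) (f : V -> R) x :
  is_derive x 0 f 0.
Proof.
apply/is_derive_line; under eq_fun do rewrite scaler0 add0r.
exact: is_derive_cst.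
Qed.

(** The derivative is the pointwise limit of the difference quotients with steps [1/(m+1)], each
    measurable in [t]. *)
Lemma measurable_derive (R : realType) (V : normedModType R)
    (d : measure_display) (T : measurableType d) (F : V -> T -> R) (x v : V) :
  (forall z, measurable_fun setT (F z)) ->
  (forall t, derivable (F^~ t) x v) ->
  measurable_fun setT (fun t => 'D_v (F^~ t) x).
Proof.
move=> mF dF; pose u (m : nat) : R := m.+1%:R^-1.
apply: (@measurable_fun_cvg _ _ _ _
  (fun m t => (u m)^-1 * (F (u m *: v + x) t - F x t))) => [m|t _].
  by apply: measurable_funM => //; exact: measurable_funB.
(* Derivability is a limit in the punctured neighbourhood of 0; it passes to any sequence of nonzero
   steps tending to 0. *)
have /cvgr_dnbhsP := dF t.
apply; split=> [m|]; first by rewrite gt_eqF// invr_gt0 ltr0n.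
exact: cvg_harmonic.
Qed.

(** * Score and Hessian of the log-odds model, pointwise in [x] *)

Section LogOddsModel.
Context {R : realType} {TX TY : Type} {S K : nat}.
Variables (psi : 'rV[R]_S -> TX -> TY -> R) (y : 'I_K.+1 -> TY).
Hypothesis psiC3 : forall x k, C3 (fun th => psi th x (y k)).

(** The parameter comes last, so that [pstar psi y k lam x] is convertible with the softmax weight
    of [logit x]. *)
Definition logit (x : TX) (k : 'I_K.+1) (lam : 'rV[R]_(S + K)) : R :=
  gam (rsubmx lam) k + psi (lsubmx lam) x (y k).

Lemma is_derive_gam k (lam v : 'rV[R]_(S + K)) :
  is_derive lam v (fun l => gam (rsubmx l) k) (gam (rsubmx v) k).
Proof.
rewrite /gam; case: unliftP => [j _|_]; last exact: is_derive_cst.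
rewrite mxE; under eq_fun do rewrite mxE.
exact: is_derive_coord.
Qed.

Lemma lsubmx_basis_l (i : 'I_S) : lsubmx (ebasis R (lshift K i)) = ebasis R i.
Proof. by apply/rowP => j; rewrite !mxE eq_lshift. Qed.

Lemma lsubmx_basis_r (l : 'I_K) : lsubmx (ebasis R (rshift S l)) = 0 :> 'rV_S.
Proof. by apply/rowP => j; rewrite !mxE eq_lrshift. Qed.

Lemma gam_basis_l (i : 'I_S) k : gam (rsubmx (ebasis R (lshift K i))) k = 0.
Proof. by rewrite /gam; case: unliftP => // j _; rewrite !mxE eq_rlshift. Qed.

Lemma gam_basis_r (l : 'I_K) k :
  gam (rsubmx (ebasis R (rshift S l))) k = (k == lift ord0 l)%:R.
Proof.
rewrite /gam; case: unliftP => [j ->|->] //.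
by rewrite !mxE eq_rshift (inj_eq lift_inj).
Qed.

Lemma is_derive_comp_lsubmx (f : 'rV[R]_S -> R) (lam v : 'rV[R]_(S + K)) df :
  is_derive (lsubmx lam) (lsubmx v) f df -> is_derive lam v (f \o lsubmx) df.
Proof.
exact: (@is_derive_comp_linear _ _ _
  (lsubmx : {linear 'rV[R]_(S + K) -> 'rV[R]_S})).
Qed.

Lemma is_derive_logit_l x k (lam : 'rV[R]_(S + K)) (i : 'I_S) :
  is_derive lam (ebasis R (lshift K i)) (logit x k)
    (partial (fun th => psi th x (y k)) i (lsubmx lam)).
Proof.
rewrite -[X in is_derive _ _ _ X]add0r -(gam_basis_l i k).
apply: is_deriveD; first exact: is_derive_gam.
apply: (is_derive_comp_lsubmx (fun th => psi th x (y k))).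
rewrite lsubmx_basis_l; apply: derivableP.
by have [_ [h _]] := psiC3 x k; exact: h.
Qed.

(** A gamma direction has zero theta component, so the [psi] term contributes 0 and only the linear
    gamma term remains. *)
Lemma is_derive_logit_r x k (lam : 'rV[R]_(S + K)) (l : 'I_K) :
  is_derive lam (ebasis R (rshift S l)) (logit x k) (k == lift ord0 l)%:R.
Proof.
rewrite -[X in is_derive _ _ _ X]addr0 -gam_basis_r.
apply: is_deriveD; first exact: is_derive_gam.
apply: (is_derive_comp_lsubmx (fun th => psi th x (y k))).
by rewrite lsubmx_basis_r; exact: is_derive_dir0.
Qed.

Lemma partial_logit_r x k (lam : 'rV[R]_(S + K)) (l : 'I_K) :
  partial (logit x k) (rshift S l) lam = (k == lift ord0 l)%:R.
Proof. by have [_] := is_derive_logit_r x k lam l. Qed.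

Lemma derivable_logit x k lam i : derivable (logit x k) lam (ebasis R i).
Proof.
case: (split_ordP i) => j ->.
  by have [] := is_derive_logit_l x k lam j.
by have [] := is_derive_logit_r x k lam j.
Qed.

(** Theta partials depend on theta alone: [C3] handles theta directions, and gamma directions give
    0. Gamma partials are constant. *)
Lemma derivable_partial_logit x k lam i j :
  derivable (partial (logit x k) i) lam (ebasis R j).
Proof.
case: (split_ordP i) => i' ->.
- have -> : partial (logit x k) (lshift K i') =
      partial (fun th => psi th x (y k)) i' \o lsubmx.
    by apply/funext => l; have [_] := is_derive_logit_l x k l i'.
  case: (split_ordP j) => j' ->.
  + have h : is_derive (lsubmx lam) (lsubmx (ebasis R (lshift K j')))
        (partial (fun th => psi th x (y k)) i')
        ('D_(ebasis R j') (partial (fun th => psi th x (y k)) i') (lsubmx lam)).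
      rewrite lsubmx_basis_l; apply: derivableP.
      by have [_ [_ [_ [h _]]]] := psiC3 x k; exact: h.
    by have [] := is_derive_comp_lsubmx _ _ _ _ h.
  + suff [] : is_derive lam (ebasis R (rshift S j'))
      (partial (fun th => psi th x (y k)) i' \o lsubmx) 0 by [].
    apply: is_derive_comp_lsubmx; rewrite lsubmx_basis_r.
    exact: is_derive_dir0.
- have -> : partial (logit x k) (rshift S i') = cst (k == lift ord0 i')%:R.
    by apply/funext => l; rewrite partial_logit_r.
  exact: derivable_cst.
Qed.

Lemma is_derive_logp k x lam i :
  is_derive lam (ebasis R i) (fun l => logp psi y k l x)
    (partial (logit x k) i lam -
     smean (logit x) lam (fun l => partial (logit x l) i lam)).
Proof.
by apply: is_derive_ln_softmax => l; apply: derivableP; exact: derivable_logit.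
Qed.

Lemma gradE k x lam i :
  grad psi y k lam x i = partial (logit x k) i lam -
     smean (logit x) lam (fun l => partial (logit x l) i lam).
Proof. by have [_] := is_derive_logp k x lam i. Qed.

(** The bracket after the minus sign does not depend on [k]: it is the Hessian of the log-partition
    function. *)
Lemma is_derive_grad k x lam i j :
  is_derive lam (ebasis R j) (partial (fun l => logp psi y k l x) i)
    (partial (partial (logit x k) i) j lam -
     (smean (logit x) lam (fun l => partial (partial (logit x l) i) j lam) +
      smean (logit x) lam
        (fun l => partial (logit x l) i lam * grad psi y l lam x j))).
Proof.
rewrite (_ : partial _ i = partial (logit x k) i -
  (fun lam => smean (logit x) lam (fun l => partial (logit x l) i lam))); last first.
  by apply/funext => l; exact: gradE.
apply: is_deriveB; first by apply: derivableP; exact: derivable_partial_logit.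
(* By [gradE] the score is the centred logit partial, which is the form [is_derive_smean]
   produces. *)
rewrite (_ : (fun l => _ * grad _ _ _ _ _ _) =
    (fun l => partial (logit x l) i lam * (partial (logit x l) j lam -
      smean (logit x) lam (fun l => partial (logit x l) j lam)))).
  apply: (is_derive_smean _ _ _ _ _ (fun l => partial (logit x l) i)) => l;
    apply: derivableP.
    exact: derivable_logit.
  exact: derivable_partial_logit.
by apply/funext => l; rewrite gradE.
Qed.

Lemma hessE k x lam i j :
  hess psi y k lam x i j = partial (partial (logit x k) i) j lam -
     (smean (logit x) lam (fun l => partial (partial (logit x l) i) j lam) +
      smean (logit x) lam
        (fun l => partial (logit x l) i lam * grad psi y l lam x j)).
Proof. by have [_] := is_derive_grad k x lam i j. Qed.

Lemma smean_grad x lam i :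
  smean (logit x) lam (fun k => grad psi y k lam x i) = 0.
Proof.
rewrite /smean; under eq_bigr do rewrite gradE mulrBr.
by rewrite sumrB -mulr_suml sum_softmax mul1r subrr.
Qed.

(** The gamma score is the indicator of category [l] (shifted by [lift]) minus a constant [m]; the
    constant drops out because scores average to 0. *)
Lemma smean_grad_gam x lam (l : 'I_K) j :
  smean (logit x) lam
    (fun k => grad psi y k lam x (rshift S l) * grad psi y k lam x j) =
  softmax (logit x) (lift ord0 l) lam * grad psi y (lift ord0 l) lam x j.
Proof.
set m := smean (logit x) lam (fun k => partial (logit x k) (rshift S l) lam).
transitivity (
  smean (logit x) lam (fun k => (k == lift ord0 l)%:R * grad psi y k lam x j) -
  m * smean (logit x) lam (fun k => grad psi y k lam x j)).
  rewrite /smean mulr_sumr -sumrB; apply: eq_bigr => k _.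
  rewrite [grad _ _ _ _ _ (rshift _ _)]gradE partial_logit_r -/m.
  by ring.
rewrite smean_grad mulr0 subr0 /smean (bigD1 (lift ord0 l))//= eqxx mul1r.
by rewrite big1 ?addr0// => k /negPf->; rewrite mul0r mulr0.
Qed.

(** Pointwise information identity: averaging cancels the second derivatives of the logits and
    leaves the covariance of their first derivatives. *)
Lemma smean_hess x lam i j :
  smean (logit x) lam (fun k => - hess psi y k lam x i j) =
  smean (logit x) lam (fun k => grad psi y k lam x i * grad psi y k lam x j).
Proof.
set m := smean (logit x) lam (fun k => partial (logit x k) i lam).
set a := smean (logit x) lam (fun l => partial (partial (logit x l) i) j lam).
set b := smean (logit x) lam
        (fun l => partial (logit x l) i lam * grad psi y l lam x j).
(* The inserted term is 0; it centres the logit partial in direction [i], turning it into a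
   score. *)
transitivity (b - m * smean (logit x) lam (fun k => grad psi y k lam x j)).
  rewrite smean_grad mulr0 subr0.
  transitivity ((a + b) * (\sum_(k < K.+1) softmax (logit x) k lam) -
      \sum_(k < K.+1)
        softmax (logit x) k lam * partial (partial (logit x k) i) j lam).
    rewrite mulr_sumr -sumrB; apply: eq_bigr => k _.
    by rewrite hessE -/a -/b; ring.
  by rewrite sum_softmax -/(smean _ _ _) -/a; ring.
rewrite /b /smean mulr_sumr -sumrB; apply: eq_bigr => k _.
by rewrite [grad _ _ _ _ _ i]gradE -/m; ring.
Qed.

End LogOddsModel.

(** * Matrix identities around the block containing [W] *)

Lemma mulmx_dr_block (F : pzRingType) (S K : nat) (A : 'M[F]_(S + K)) (W : 'M[F]_K) :
  A *m block_mx 0 0 0 W *m A = rsubmx A *m W *m dsubmx A.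
Proof.
have -> : A *m block_mx 0 0 0 W = row_mx (0 : 'M[F]_(S + K, S)) (rsubmx A *m W).
  by rewrite -{1}[A]hsubmxK mul_row_block !mulmx0 !addr0 add0r.
by rewrite -{2}[A]vsubmxK mul_row_col mul0mx add0r.
Qed.

(** [W] is a diagonal matrix with entries [1/n_k] plus the all-ones matrix times [1/n_0]. The
    diagonal part undoes the row scaling of [M]; the other part sees only the column sums of [M],
    which equal [- n_0 mu_0]. *)
Lemma Wmat_quad (R : realType) (K m : nat) (nk : 'I_K.+1 -> nat)
    (mu : 'I_K.+1 -> 'rV[R]_m) (M : 'M[R]_(K, m)) :
  (forall k, (0 < nk k)%N) ->
  \sum_(k < K.+1) (nk k)%:R *: mu k = 0 ->
  (forall l, row l M = (nk (lift ord0 l))%:R *: mu (lift ord0 l)) ->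
  M^T *m Wmat R nk *m M = \sum_(k < K.+1) (nk k)%:R *: ((mu k)^T *m mu k).
Proof.
move=> nk0 smu rowM.
have nkE k : (nk k)%:R != 0 :> R by rewrite pnatr_eq0 -lt0n.
have ME l j : M l j = (nk (lift ord0 l))%:R * mu (lift ord0 l) 0 j.
  by have /rowP/(_ j) := rowM l; rewrite !mxE.
have sM j : \sum_(l < K) M l j = - ((nk ord0)%:R * mu ord0 0 j).
  have sM0 : (nk ord0)%:R * mu ord0 0 j + \sum_(l < K) M l j = 0.
    have /rowP/(_ j) := smu; rewrite summxE big_ord_recl !mxE => {2}<-.
    by congr (_ + _); apply: eq_bigr => l _; rewrite ME !mxE.
  by apply/eqP; rewrite -addr_eq0 addrC sM0.
apply/matrixP => i j; rewrite mxE.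
(* The diagonal part gives [mu_l], the all-ones part gives [- mu_0]. *)
have MW l : (M^T *m Wmat R nk) i l = mu (lift ord0 l) 0 i - mu ord0 0 i.
  rewrite mxE.
  transitivity (\sum_(k < K)
      ((k == l)%:R * mu (lift ord0 l) 0 i + M k i / (nk ord0)%:R)).
    apply: eq_bigr => k _; rewrite !mxE mul1r mulrDr; congr (_ + _).
    case: eqVneq => [->|_]; last by rewrite !mul0r mulr0.
    by rewrite !mul1r ME mulrAC divff// mul1r.
  rewrite big_split/= -!mulr_suml sM mulNr mulrAC divff// mul1r; congr (_ - _).
  by rewrite (bigD1 l)//= eqxx big1 ?addr0 ?mul1r// => k /negPf->.
rewrite summxE big_ord_recl.
transitivity (\sum_(l < K) (mu (lift ord0 l) 0 i * M l j) -
    mu ord0 0 i * \sum_(l < K) M l j).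
  by rewrite mulr_sumr -sumrB; apply: eq_bigr => l _; rewrite MW mulrBl.
(* The two minus signs cancel, and [n_0 mu_0^T mu_0] appears as the term of index 0. *)
rewrite sM mulrN opprK addrC; congr (_ + _).
  by apply: eq_bigr => l _; rewrite ME !mxE big_ord1 !mxE; ring.
by rewrite !mxE big_ord1 !mxE mulrCA.
Qed.

(** A nonzero [v] with [v *m A = 0] would make the quadratic form vanish at [v]. *)
Lemma posdef_unitmx (F : numFieldType) (m : nat) (A : 'M[F]_m) :
  (forall v : 'rV[F]_m, v != 0 -> 0 < (v *m A *m v^T) ord0 ord0) -> A \in unitmx.
Proof.
move=> Apd; rewrite -row_free_unit; apply: inj_row_free => v vA0.
apply/eqP; apply: contraT => /Apd.
by rewrite vA0 mul0mx mxE ltxx.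
Qed.

(** * Expectations under a density, and mixtures of them *)

Section Expectation.
Context {R : realType} {d : measure_display} {T : measurableType d}.
Variables (nu : {measure set T -> \bar R}) (f : T -> R).
Hypotheses (f_meas : measurable_fun setT f) (f_pos : forall x, 0 < f x).
Hypothesis f_int1 : (\int[nu]_x (f x)%:E = 1)%E.

Definition dens_integrable (a : T -> R) : Prop :=
  nu.-integrable setT (EFin \o (fun x => a x * f x)).

Lemma dens_integrable_cst c : dens_integrable (cst c).
Proof.
rewrite /dens_integrable.
have -> : EFin \o (fun x => cst c x * f x) = (fun x => c%:E * (EFin \o f) x)%E by [].
apply: integrableZl => //; apply/integrableP; split; first exact/measurable_EFinP.
under eq_integral do rewrite /= gtr0_norm//.
by rewrite f_int1 ltry.
Qed.

Lemma dens_integrableD a b :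
  dens_integrable a -> dens_integrable b -> dens_integrable (fun x => a x + b x).
Proof.
move=> ha hb; rewrite /dens_integrable.
have -> : EFin \o (fun x => (a x + b x) * f x) =
  (EFin \o (fun x => a x * f x)) \+ (EFin \o (fun x => b x * f x)).
  by apply/funext => x /=; rewrite mulrDl.
exact: integrableD.
Qed.

Lemma dens_integrableZ c a :
  dens_integrable a -> dens_integrable (fun x => c * a x).
Proof.
move=> ha; rewrite /dens_integrable.
have -> : EFin \o (fun x => c * a x * f x) =
  (fun x => c%:E * (EFin \o (fun x => a x * f x)%R) x)%E.
  by apply/funext => x /=; rewrite -mulrA.
exact: integrableZl.
Qed.

Lemma dens_integrable_le (a b : T -> R) :
  measurable_fun setT a -> (forall x, `|a x| <= b x) ->
  dens_integrable b -> dens_integrable a.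
Proof.
move=> ma ab; apply: le_integrable => //.
  by apply/measurable_EFinP; exact: measurable_funM.
move=> x _ /=; rewrite lee_fin !normrM ler_wpM2r//.
exact: le_trans (ab x) (ler_norm _).
Qed.

Lemma dens_integrable_ge0 (a : T -> R) :
  measurable_fun setT a -> (forall x, 0 <= a x) ->
  (\int[nu]_x (a x * f x)%:E < +oo)%E -> dens_integrable a.
Proof.
move=> ma a0 afin; apply/integrableP; split.
  by apply/measurable_EFinP; exact: measurable_funM.
by under eq_integral do rewrite /= ger0_norm ?mulr_ge0 ?(ltW (f_pos _))//.
Qed.

Lemma Edens_cst c : Edens nu f (cst c) = c.
Proof.
(* [Edens] is convertible with a real-valued integral, so linearity of the latter applies. *)
rewrite -[LHS]/(\int[nu]_x (c * f x)) RintegralZl//.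
  by rewrite /Rintegral f_int1/= mulr1.
have := dens_integrable_cst 1; rewrite /dens_integrable.
by under [X in EFin \o X]eq_fun do rewrite /= mul1r.
Qed.

Lemma EdensD a b : dens_integrable a -> dens_integrable b ->
  Edens nu f (fun x => a x + b x) = Edens nu f a + Edens nu f b.
Proof.
move=> ha hb; rewrite -[RHS]RintegralD//.
by congr fine; apply: eq_integral => x _; rewrite mulrDl.
Qed.

Lemma EdensZ c a : dens_integrable a ->
  Edens nu f (fun x => c * a x) = c * Edens nu f a.
Proof.
move=> ha; rewrite -[RHS]RintegralZl//.
by congr fine; apply: eq_integral => x _; rewrite mulrA.
Qed.

Lemma Edens_mulC a b :
  Edens nu f (fun x => a x * b x) = Edens nu f (fun x => b x * a x).
Proof. by congr Edens; apply/funext => x; rewrite mulrC. Qed.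

Lemma Edens_cov a b : dens_integrable a -> dens_integrable b ->
  dens_integrable (fun x => a x * b x) ->
  Edens nu f (fun x => (a x - Edens nu f a) * (b x - Edens nu f b)) =
  Edens nu f (fun x => a x * b x) - Edens nu f a * Edens nu f b.
Proof.
move=> ha hb hab; set ma := Edens nu f a; set mb := Edens nu f b.
transitivity (Edens nu f (fun x => a x * b x + ((- ma) * b x +
   ((- mb) * a x + cst (ma * mb) x)))).
  by congr Edens; apply/funext => x /=; ring.
have hc := dens_integrable_cst (ma * mb).
have h1 := dens_integrableZ (- mb) _ ha.
have h2 := dens_integrableZ (- ma) _ hb.
have h3 := dens_integrableD _ _ h1 hc.
have h4 := dens_integrableD _ _ h2 h3.
rewrite EdensD// EdensD// EdensD// EdensZ// EdensZ//.
by rewrite [X in _ + (_ + (_ + X))]Edens_cst -/ma -/mb; ring.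
Qed.

End Expectation.

(** Integrability merges the expectations under different densities into one [nu]-integral, so the
    integrands need only agree after summation over [k]. *)
Lemma Edens_mixture_eq (R : realType) (d : measure_display) (T : measurableType d)
    (nu : {measure set T -> \bar R}) (m : nat) (f : 'I_m -> T -> R) (r : 'I_m -> R)
    (a b : 'I_m -> T -> R) :
  (forall k, dens_integrable nu (f k) (a k)) ->
  (forall k, dens_integrable nu (f k) (b k)) ->
  (forall x, \sum_(k < m) a k x * (r k * f k x) = \sum_(k < m) b k x * (r k * f k x)) ->
  \sum_(k < m) r k * Edens nu (f k) (a k) = \sum_(k < m) r k * Edens nu (f k) (b k).
Proof.
have mixE (c : 'I_m -> T -> R) : (forall k, dens_integrable nu (f k) (c k)) ->
    \sum_(k < m) r k * Edens nu (f k) (c k) =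
    \int[nu]_x (\sum_(k < m) c k x * (r k * f k x)).
  move=> hc; rewrite /Rintegral; under eq_integral do rewrite -sumEFin.
  have hi k : nu.-integrable setT (fun x => (c k x * (r k * f k x))%:E).
    rewrite (_ : (fun x => _) =
      (fun x => (r k)%:E * (EFin \o (fun x => c k x * f k x)%R) x)%E).
      by apply: integrableZl => //; exact: hc.
    by apply/funext => x /=; rewrite -EFinM mulrCA.
  rewrite (integral_sum measurableT hi) -sum_fine; last first.
    by move=> k _; apply: integrable_fin_num => //; exact: hi.
  apply: eq_bigr => k _; rewrite -[LHS]RintegralZl//; last exact: hc.
  by congr fine; apply: eq_integral => x _; rewrite mulrCA.
move=> ha hb ab; rewrite !mixE//.
by congr fine; apply: eq_integral => x _; rewrite ab.
Qed.

Lemma measurable_logp (R : realType) (d : measure_display) (TX : measurableType d)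
    (TY : Type) (S K : nat) (psi : 'rV[R]_S -> TX -> TY -> R) (y : 'I_K.+1 -> TY) :
  (forall th k, measurable_fun setT (fun x => psi th x (y k))) ->
  forall k lam, measurable_fun setT (logp psi y k lam).
Proof.
move=> psi_meas k lam.
have logit_meas l : measurable_fun setT (fun x => logit psi y x l lam).
  by apply: measurable_funD => //; exact: measurable_cst.
rewrite (_ : logp psi y k lam = (fun x => logit psi y x k lam -
    ln (\sum_(l < K.+1) expR (logit psi y x l lam)))); last first.
  by apply/funext => x; rewrite -ln_softmaxE.
apply: measurable_funB => //; apply: measurableT_comp; first exact: measurable_ln.
by apply: measurable_sum => l; exact: measurableT_comp.
Qed.

(** * Moments of the score at the true parameter *)

Section ScoreMoments.
Context {R : realType} {d : measure_display} {TX : measurableType d} {TY : Type}.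
Context {S K : nat}.
Variables (nu : {measure set TX -> \bar R}) (y : 'I_K.+1 -> TY).
Variable psi : 'rV[R]_S -> TX -> TY -> R.
Hypothesis psi0 : forall th x, psi th x (y ord0) = 0.
Hypothesis psi_meas : forall th k, measurable_fun setT (fun x => psi th x (y k)).
Hypothesis psiC3 : forall x k, C3 (fun th => psi th x (y k)).
Variables (theta0 : 'rV[R]_S) (beta : TX -> R) (eps : 'I_K.+1 -> R).
Variables (f : 'I_K.+1 -> TX -> R) (r : 'I_K.+1 -> R).
Hypothesis f_meas : forall k, measurable_fun setT (f k).
Hypothesis f_pos : forall k x, 0 < f k x.
Hypothesis f_int1 : forall k, (\int[nu]_x (f k x)%:E = 1)%E.
Hypothesis f_log : forall k x, ln (f k x) = beta x + psi theta0 x (y k) - eps k.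
Hypothesis r_pos : forall k, 0 < r k.

Let lam := lam0 theta0 r eps.
Let g k i x := grad psi y k lam x i.
Let h k i j x := hess psi y k lam x i j.

Hypothesis grad2_fin : forall k,
  (\int[nu]_x ((\sum_(i < S + K) g k i x ^+ 2) * f k x)%:E < +oo)%E.
Hypothesis hess_fin : forall k,
  (\int[nu]_x ((\sum_(i < S + K) \sum_(j < S + K) `|h k i j x|) * f k x)%:E < +oo)%E.

Lemma measurable_grad k i lam' : measurable_fun setT (fun x => grad psi y k lam' x i).
Proof.
apply: (measurable_derive _ _ _ _ (fun l x => logp psi y k l x)) => [l|x].
  exact: measurable_logp.
by have [] := is_derive_logp _ _ psiC3 k x lam' i.
Qed.

Lemma measurable_hess k i j : measurable_fun setT (h k i j).
Proof.
apply: (measurable_derive _ _ _ _ (fun l x => grad psi y k l x i)) => [l|x].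
  exact: measurable_grad.
by have [] := is_derive_grad _ _ psiC3 k x lam i j.
Qed.

(** The squared norm of the score, from which integrable bounds for scores and their products are
    built. *)
Let sqn k x := \sum_(i < S + K) g k i x ^+ 2.

Let sqn_integrable k : dens_integrable nu (f k) (sqn k).
Proof.
apply: dens_integrable_ge0 => //.
- by apply: measurable_sum => i; apply: measurable_funX; exact: measurable_grad.
- by move=> x; apply: sumr_ge0 => i _; exact: sqr_ge0.
- exact: grad2_fin.
Qed.

Let sqr_le_sqn k i x : g k i x ^+ 2 <= sqn k x.
Proof.
by rewrite /sqn (bigD1 i)//= lerDl; apply: sumr_ge0 => j _; exact: sqr_ge0.
Qed.

Lemma grad_integrable k i : dens_integrable nu (f k) (g k i).
Proof.
apply: (@dens_integrable_le _ _ _ _ _ _ _ (fun x => sqn k x + cst 1 x)) => //.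
- exact: measurable_grad.
(* From [(|a| - 1)^2 >= 0] follows [|a| <= a^2 + 1]. *)
- move=> x /=; have := sqr_le_sqn k i x; rewrite -real_normK ?num_real//.
  move: `|g k i x| (sqn k x) (sqr_ge0 (`|g k i x| - 1)) (normr_ge0 (g k i x)).
  by move=> a s; rewrite sqrrB1 mulr2n; lra.
- by apply: dens_integrableD => //; exact: dens_integrable_cst.
Qed.

Lemma gradM_integrable k i j : dens_integrable nu (f k) (fun x => g k i x * g k j x).
Proof.
apply: (@dens_integrable_le _ _ _ _ _ _ _ (sqn k)) => //.
  by apply: measurable_funM; exact: measurable_grad.
move=> x; rewrite ler_norml.
move: (sqr_le_sqn k i x) (sqr_le_sqn k j x); move: (g k i x) (g k j x) => a b.
(* These squares give [2 |a b| <= a^2 + b^2], and each of [a^2], [b^2] is at most [sqn]. *)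
move: (sqr_ge0 (a - b)) (sqr_ge0 (a + b)); rewrite sqrrB sqrrD !mulr2n.
by move=> *; apply/andP; split; lra.
Qed.

Lemma hessN_integrable k i j : dens_integrable nu (f k) (fun x => - h k i j x).
Proof.
apply: (@dens_integrable_le _ _ _ _ _ _ _
  (fun x => \sum_(i < S + K) \sum_(j < S + K) `|h k i j x|)) => //.
- by apply: measurable_funN; exact: measurable_hess.
- move=> x; apply: (@le_trans _ _ (\sum_(j' < S + K) `|h k i j' x|)).
    by rewrite normrN (bigD1 j)//= lerDl sumr_ge0.
  rewrite [leRHS](bigD1 i)//= lerDl; apply: sumr_ge0 => i' _.
  exact: sumr_ge0.
- apply: dens_integrable_ge0 => //.
    apply: measurable_sum => i'; apply: measurable_sum => j'.
    by apply: measurableT_comp => //; exact: measurable_hess.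
  by move=> x; apply: sumr_ge0 => ? _; exact: sumr_ge0.
Qed.

(** The true gamma makes the logit equal to the log of [r_k f_k] up to a term free of [k]; at index
    0 both sides vanish by [psi0]. *)
Lemma logit_lam0 x k :
  logit psi y x k lam = ln (r k) + ln (f k x) - beta x - ln (r ord0) + eps ord0.
Proof.
rewrite /logit /lam /lam0 row_mxKl row_mxKr f_log /gam.
by case: unliftP => [l ->|->]; rewrite ?mxE ?psi0; ring.
Qed.

(** The constant is chosen before [a], so the same [c] serves both sides of a pointwise identity. *)
Lemma mixture_softmax x :
  exists c, forall a : 'I_K.+1 -> R,
    \sum_(k < K.+1) a k * (r k * f k x) = c * smean (logit psi y x) lam a.
Proof.
(* This is the ratio of [r_k f_k] to the exponential of the logit, the same for all [k]; hence [c]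
   is the mixture density. *)
pose e := expR (beta x + ln (r ord0) - eps ord0).
exists (e * \sum_(l < K.+1) expR (logit psi y x l lam)) => b.
rewrite /smean mulr_sumr; apply: eq_bigr => k _.
have -> : r k * f k x = e * expR (logit psi y x k lam).
  rewrite -expRD logit_lam0 -[LHS]lnK ?posrE ?mulr_gt0// lnM ?posrE//.
  by congr expR; ring.
rewrite /softmax; field; exact/lt0r_neq0/sum_expR_gt0.
Qed.

Definition mean_score k : 'rV[R]_(S + K) := \row_i Edens nu (f k) (g k i).

Let A := Ibar nu f r psi y lam.

Lemma Ibar_gradE i j :
  A i j = \sum_(k < K.+1) r k * Edens nu (f k) (fun x => g k i x * g k j x).
Proof.
rewrite mxE; apply: Edens_mixture_eq => [k|k|x].
- exact: hessN_integrable.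
- exact: gradM_integrable.
- by have [c cE] := mixture_softmax x; rewrite !cE smean_hess.
Qed.

Lemma sum_mean_score : \sum_(k < K.+1) r k *: mean_score k = 0.
Proof.
apply/rowP => i; rewrite summxE mxE.
(* Zero is written as a mixture so that [Edens_mixture_eq] reduces the claim to [smean_grad]. *)
transitivity (\sum_(k < K.+1) r k * Edens nu (f k) (cst 0)).
  under eq_bigr do rewrite !mxE.
  apply: Edens_mixture_eq => [k|k|x].
  - exact: grad_integrable.
  - exact: dens_integrable_cst.
  - have [c cE] := mixture_softmax x; rewrite !cE smean_grad// /smean.
    by rewrite big1// => k _; rewrite /= mulr0.
by apply: big1 => k _; rewrite Edens_cst// mulr0.
Qed.

Lemma row_Ibar_gam l j :
  A (rshift S l) j = r (lift ord0 l) * mean_score (lift ord0 l) 0 j.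
Proof.
set k0 := lift ord0 l.
rewrite Ibar_gradE.
(* The indicator presents the single expectation under [f k0] as a mixture over all categories,
   comparable through [smean_grad_gam]. *)
transitivity (\sum_(k < K.+1) r k * Edens nu (f k) (fun x => (k == k0)%:R * g k j x)).
  apply: Edens_mixture_eq => [k|k|x].
  - exact: gradM_integrable.
  - by apply: dens_integrableZ => //; exact: grad_integrable.
  - have [c cE] := mixture_softmax x; rewrite !cE smean_grad_gam//.
    rewrite /smean [in RHS](bigD1 k0)//= eqxx mul1r big1 ?addr0// => k /negPf->.
    by rewrite mul0r mulr0.
rewrite (bigD1 k0)//= eqxx big1 ?addr0.
  by rewrite !mxE EdensZ ?mul1r//; exact: grad_integrable.
by move=> k /negPf->; rewrite EdensZ ?mul0r ?mulr0//; exact: grad_integrable.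
Qed.

Lemma Ibar_sym : A^T = A.
Proof.
apply/matrixP => i j; rewrite mxE !Ibar_gradE.
(* Unification of the two products would unfold the derivatives in [g]. *)
exact (eq_bigr _ (fun k _ =>
  congr1 ( *%R (r k)) (Edens_mulC _ _ (g k j) (g k i)))).
Qed.

(** Each covariance is a second moment minus a product of means; the second moments add up to [Ibar]
    by [Ibar_gradE] and cancel. *)
Lemma Ibar_sub_Sigbar :
  A - Sigbar nu f r psi y lam =
  \sum_(k < K.+1) r k *: ((mean_score k)^T *m mean_score k).
Proof.
apply/matrixP => i j; rewrite mxE Ibar_gradE mxE !summxE -sumrB.
refine (eq_bigr _ _) => k _.
rewrite mxE [X in _ - r k * X]mxE [RHS]mxE [X in _ = _ * X]mxE big_ord1 !mxE.
rewrite Edens_cov//; first by rewrite mulrBr opprB addrC subrK.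
- exact: grad_integrable.
- exact: grad_integrable.
- exact: gradM_integrable.
Qed.

End ScoreMoments.

(** * Assembly of the two identities between information and score covariance *)

Theorem theorem3
  (R : realType) (d : measure_display) (TX : measurableType d)
  (d' : measure_display) (TY : measurableType d')
  (nu : {measure set TX -> \bar R}) (hnu : sigma_finite setT nu)
  (K : nat) (hK : (0 < K)%N) (y : 'I_K.+1 -> TY) (hy : injective y)
  (S : nat) (hS : (0 < S)%N)
  (psi : 'rV[R]_S -> TX -> TY -> R)
  (hpsi0 : forall th x, psi th x (y ord0) = 0)
  (hpsimeas : forall th k, measurable_fun setT (fun x => psi th x (y k)))
  (hpsiC3 : forall x k, C3 (fun th => psi th x (y k)))
  (theta0 : 'rV[R]_S) (beta : TX -> R) (hbeta : measurable_fun setT beta)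
  (eps : 'I_K.+1 -> R) (f : 'I_K.+1 -> TX -> R)
  (hfmeas : forall k, measurable_fun setT (f k))
  (hfpos : forall k x, 0 < f k x)
  (hfprob : forall k, (\int[nu]_x (f k x)%:E = 1)%E)
  (hflog : forall k x, ln (f k x) = beta x + psi theta0 x (y k) - eps k)
  (r : 'I_K.+1 -> R) (hrpos : forall k, 0 < r k)
  (hrsum : \sum_(k < K.+1) r k = 1)
  (n : nat) (nk : 'I_K.+1 -> nat) (hnk : forall k, (nk k)%:R = r k * n%:R)
  (Imat := n%:R *: Ibar nu f r psi y (lam0 theta0 r eps))
  (Sig := n%:R *: Sigbar nu f r psi y (lam0 theta0 r eps))
  (hIpd : forall v : 'rV[R]_(S + K), v != 0 -> 0 < (v *m Imat *m v^T) ord0 ord0)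
  (hgrad2 : forall k, (\int[nu]_x
       ((\sum_(i < S + K) (grad psi y k (lam0 theta0 r eps) x i) ^+ 2) * f k x)%:E
       < +oo)%E)
  (hhess : forall k, (\int[nu]_x
       ((\sum_(i < S + K) \sum_(j < S + K)
           `|hess psi y k (lam0 theta0 r eps) x i j|) * f k x)%:E < +oo)%E) :
  (Imat - Sig = Imat *m block_mx 0 0 0 (Wmat R nk) *m Imat) /\
  (ulsubmx (invmx Imat) = ulsubmx (invmx Imat *m Sig *m invmx Imat)).
Proof.
pose mu := @mean_score _ _ _ _ _ _ nu y psi theta0 eps f r.
have Ibar_sym0 := Ibar_sym nu y psi hpsi0 hpsimeas hpsiC3 theta0 beta eps f r
    hfmeas hfpos hflog hrpos hgrad2 hhess.
have row_Ibar := row_Ibar_gam nu y psi hpsi0 hpsimeas hpsiC3 theta0 beta eps f r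
    hfmeas hfpos hfprob hflog hrpos hgrad2 hhess.
have sum_mu := sum_mean_score nu y psi hpsi0 hpsimeas hpsiC3 theta0 beta eps f r
    hfmeas hfpos hfprob hflog hrpos hgrad2.
have Ibar_sub := Ibar_sub_Sigbar nu y psi hpsi0 hpsimeas hpsiC3 theta0 beta eps f r
    hfmeas hfpos hfprob hflog hrpos hgrad2 hhess.
have Iunit : Imat \in unitmx by exact: posdef_unitmx.
(* For [n = 0] the information would be the zero matrix, contradicting positivity at a gamma basis
   vector, which exists since [K > 0]. *)
have n0 : n%:R != 0 :> R.
  apply: contraT; rewrite negbK => /eqP n0.
  suff /hIpd : ebasis R (rshift S (Ordinal hK)) != 0.
    by rewrite /Imat n0 scale0r mulmx0 mul0mx mxE ltxx.
  apply/eqP => /rowP /(_ (rshift S (Ordinal hK))).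
  by rewrite !mxE !eqxx => /eqP; rewrite oner_eq0.
have nk0 k : (0 < nk k)%N.
  by rewrite lt0n -(pnatr_eq0 R) hnk mulf_neq0// gt_eqF.
have Isym : Imat^T = Imat by rewrite /Imat linearZ/= Ibar_sym0.
(* Symmetry turns the last [K] columns into transposed gamma rows, the shape [M^T W M] of
   [Wmat_quad]. *)
have rsubI : rsubmx Imat = (dsubmx Imat)^T.
  by rewrite -{1}Isym; apply/matrixP => i j; rewrite !mxE.
have part_a : Imat - Sig = Imat *m block_mx 0 0 0 (Wmat R nk) *m Imat.
  rewrite mulmx_dr_block rsubI (@Wmat_quad _ _ _ _ mu)//.
  - rewrite /Imat /Sig -scalerBr Ibar_sub scaler_sumr.
    by apply: eq_bigr => k _; rewrite hnk scalerA mulrC.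
  - under eq_bigr do rewrite hnk mulrC -scalerA.
    by rewrite -scaler_sumr sum_mu scaler0.
  - move=> l; apply/rowP => j; rewrite 3!mxE row_Ibar 2!mxE.
    by rewrite [mu _ 0 j]mxE hnk [r _ * n%:R]mulrC mulrA.
split=> //.
(* Multiplying by the inverse on both sides leaves [invmx Imat] minus the block matrix of [W], whose
   theta block is zero. *)
have -> : Sig = Imat - Imat *m block_mx 0 0 0 (Wmat R nk) *m Imat.
  by rewrite -part_a subKr.
rewrite mulmxBr mulVmx// !mulmxA mulVmx// mul1mx mulmxBl mul1mx.
rewrite -mulmxA mulmxV// mulmx1 -[in RHS](submxK (invmx Imat)).
by rewrite opp_block_mx add_block_mx block_mxKul oppr0 addr0.
Qed.
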